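(* Let $R=\mathbb{Q}[x]$, $\mathbb{Z}$-graded with $\deg x=1$, let $\sigma$ be the $\mathbb{Q}$-algebra endomorphism $\sigma(f)(x)=f(2x)$, and let $\delta$ be the $\sigma$-derivation $\delta(f)=(f(2x)-f(x))/x$. Let $A=R[t;\sigma,\delta]\cong\mathbb{Q}\langle x,t\rangle/(tx-2xt-1)$, $\mathbb{Z}$-graded with $\deg x=1$ and $\deg t=-1$. Then $R$ is $(\sigma,\delta)$-gr-simple and $\delta$ is outer, but $A$ is not gr-simple.
   Context: For a ring endomorphism $\sigma$ of $R$, a $\sigma$-derivation is an additive map $\delta\colon R\to R$ with $\delta(rs)=\delta(r)s+\sigma(r)\delta(s)$. The Ore extension $R[t;\sigma,\delta]$ is the free left $R$-module with basis $1,t,t^2,\dots$ with multiplication determined by $tr=\sigma(r)t+\delta(r)$. An ideal (two-sided) is graded if generated by homogeneous elements; a graded ring is gr-simple if $0$ and the ring itself are its only graded ideals. $R$ is $(\sigma,\delta)$-gr-simple if $0$ and $R$ are the only graded ideals $I$ of $R$ with $\sigma(I)\subseteq I$ and $\delta(I)\subseteq I$. $\delta$ is inner if there is $u\in R$ with $\delta(r)=ur-\sigma(r)u$ for all $r\in R$, and outer otherwise. *)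

(* Defs.v *)
From HB Require Import structures.
From mathcomp Require Import all_boot all_order all_algebra.
From mathcomp Require Import monalg.

Set Implicit Arguments.
Unset Strict Implicit.
Unset Printing Implicit Defensive.

Import GRing.Theory.
Local Open Scope ring_scope.

(* Subsets of a ring are arbitrary (not necessarily decidable) Prop-valued
   predicates, so that "ideal" really ranges over all ideals.                 *)

Section Graded.
Variable S : nzRingType.

Record grading := Grading {
  gr_comp :> int -> S -> Prop;
  gr0 : forall n, gr_comp n 0;
  grB : forall n x y, gr_comp n x -> gr_comp n y -> gr_comp n (x - y);
  gr1 : gr_comp 0 1;
  grM : forall m n x y, gr_comp m x -> gr_comp n y -> gr_comp (m + n) (x * y);
  gr_span : forall x, exists (r : seq int) (c : int -> S),
    (forall n, gr_comp n (c n)) /\ x = \sum_(n <- r) c n;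
  gr_indep : forall (r : seq int) (c : int -> S), uniq r ->
    (forall n, gr_comp n (c n)) -> \sum_(n <- r) c n = 0 ->
    forall n, n \in r -> c n = 0
}.

Definition homogeneous (G : grading) (x : S) : Prop := exists n, G n x.

Record is_ideal (I : S -> Prop) : Prop := IsIdeal {
  ideal0 : I 0;
  idealB : forall x y, I x -> I y -> I (x - y);
  idealMl : forall a x, I x -> I (a * x);
  idealMr : forall a x, I x -> I (x * a)
}.

Definition ideal_gen (X : S -> Prop) (s : S) : Prop :=
  forall I : S -> Prop, is_ideal I -> (forall x, X x -> I x) -> I s.

Definition graded_ideal (G : grading) (I : S -> Prop) : Prop :=
  exists X : S -> Prop, (forall x, X x -> homogeneous G x) /\
    (forall s, I s <-> ideal_gen X s).

Definition zero_or_whole (I : S -> Prop) : Prop :=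
  (forall s, I s <-> s = 0) \/ (forall s, I s).

Definition gr_simple (G : grading) : Prop :=
  forall I, graded_ideal G I -> zero_or_whole I.

End Graded.

Section SkewDerivation.
Variables (R : nzRingType) (sigma : {rmorphism R -> R}).

Record skew_derivation := SkewDerivation {
  sder :> {additive R -> R};
  sderM : forall r s, sder (r * s) = sder r * s + sigma r * sder s
}.

Variable delta : skew_derivation.

Definition inner : Prop :=
  exists u : R, forall r, delta r = u * r - sigma r * u.

Definition outer : Prop := ~ inner.

Definition sd_gr_simple (G : grading R) : Prop :=
  forall I, graded_ideal G I ->
    (forall r, I r -> I (sigma r)) -> (forall r, I r -> I (delta r)) ->
    zero_or_whole I.

End SkewDerivation.

(* The left R-module with basis 1, t, t^2, ... is realised on {poly R}, the
   coefficients being written on the left of the powers of t. Multiplication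
   on the left by t is the additive map
     \sum_j q_j t^j |-> \sum_j (sigma(q_j) t^(j+1) + delta(q_j) t^j).         *)
Section OreMul.
Variables (R : nzRingType) (sigma : {rmorphism R -> R}).
Variable delta : skew_derivation sigma.
Implicit Types (a b : R) (p q r : {poly R}).

Definition ore_shift q : {poly R} := map_poly sigma q * 'X + map_poly delta q.

Definition ore_mul p q : {poly R} :=
  \sum_(i < size p) p`_i *: iter i ore_shift q.

Lemma sder1 : delta 1 = 0.
Proof.
have := sderM delta 1 1; rewrite !mulr1 rmorph1 mul1r => /eqP.
by rewrite -subr_eq0 opprD addNKr oppr_eq0 => /eqP.
Qed.

Lemma coef_shift q j :
  (ore_shift q)`_j = (if j == 0%N then 0 else sigma q`_j.-1) + delta q`_j.
Proof. by rewrite coefD coefMX !coef_map. Qed.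

Lemma shift_is_additive : zmod_morphism ore_shift.
Proof.
move=> p q; apply/polyP=> j; rewrite coefB !coef_shift !coefB !raddfB /=.
by case: eqP => _; rewrite ?add0r // opprD addrACA.
Qed.
HB.instance Definition _ :=
  GRing.isZmodMorphism.Build {poly R} {poly R} ore_shift shift_is_additive.

Lemma shiftZ a q :
  ore_shift (a *: q) = sigma a *: ore_shift q + delta a *: q.
Proof.
apply/polyP=> j; rewrite coef_shift coefD !coefZ !coef_shift !sderM rmorphM.
by rewrite mulrDr [RHS]addrAC -addrA; case: eqP => _ //; rewrite mulr0.
Qed.

Lemma iter_shiftB i p q :
  iter i ore_shift (p - q) = iter i ore_shift p - iter i ore_shift q.
Proof. by elim: i => //= i ->; rewrite raddfB. Qed.

Lemma ore_mulE n p q : (size p <= n)%N ->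
  ore_mul p q = \sum_(i < n) p`_i *: iter i ore_shift q.
Proof.
move=> le_pn; rewrite /ore_mul.
rewrite (big_ord_widen n (fun i => p`_i *: iter i ore_shift q) le_pn).
rewrite big_mkcond; apply: eq_bigr => i _; case: ltnP => // le_pi.
by rewrite nth_default // scale0r.
Qed.

Lemma ore_mulDl : left_distributive ore_mul +%R.
Proof.
move=> p q r; set n := maxn (size p) (size q).
rewrite !(@ore_mulE n) ?leq_maxl ?leq_maxr ?size_polyD //.
by rewrite -big_split; apply: eq_bigr => i _; rewrite coefD scalerDl.
Qed.

Lemma ore_mulBr p q r : ore_mul p (q - r) = ore_mul p q - ore_mul p r.
Proof.
by rewrite -sumrB; apply: eq_bigr => i _; rewrite iter_shiftB scalerBr.
Qed.

Lemma ore_mulDr : right_distributive ore_mul +%R.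
Proof.
move=> p q r; have := ore_mulBr p (q + r) r.
by rewrite addrK => ->; rewrite subrK.
Qed.

Lemma ore_mulZl a p q : ore_mul (a *: p) q = a *: ore_mul p q.
Proof.
rewrite (ore_mulE _ (size_scale_leq a p)) scaler_sumr.
by apply: eq_bigr => i _; rewrite coefZ scalerA.
Qed.

Lemma ore_mul0l q : ore_mul 0 q = 0.
Proof. by rewrite /ore_mul size_poly0 big_ord0. Qed.

Lemma ore_mul_suml n (F : 'I_n -> {poly R}) q :
  ore_mul (\sum_i F i) q = \sum_i ore_mul (F i) q.
Proof.
by apply: (big_morph (ore_mul^~ q) (fun x y => ore_mulDl x y q) (ore_mul0l q)).
Qed.

Lemma ore_mul_shift p q : ore_mul (ore_shift p) q = ore_shift (ore_mul p q).
Proof.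
rewrite {1}/ore_shift ore_mulDl raddf_sum /=.
rewrite (@ore_mulE (size p).+1); last first.
  by apply: leq_trans (size_polyMleq _ _) _; rewrite size_polyX addn2 /= ltnS
    size_poly.
rewrite big_ord_recl coefMX eqxx scale0r add0r.
rewrite (@ore_mulE (size p) (map_poly delta p)) ?size_poly // -big_split.
apply: eq_bigr => i _; rewrite shiftZ coefMX /=.
by rewrite !coef_map.
Qed.

Lemma ore_mulA : associative ore_mul.
Proof.
move=> p q r; rewrite [ore_mul p q]/ore_mul ore_mul_suml [LHS]/ore_mul.
apply: eq_bigr => i _; rewrite ore_mulZl; congr (_ *: _).
by elim: (i : nat) => //= j ->; rewrite ore_mul_shift.
Qed.

Lemma ore_mul1l : left_id 1 ore_mul.
Proof.
by move=> p; rewrite /ore_mul size_poly1 big_ord1 coef1 eqxx scale1r.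
Qed.

Lemma iter_shift1 i : iter i ore_shift 1 = 'X^i.
Proof.
elim: i => [|i /= ->]; first by rewrite expr0.
rewrite /ore_shift map_polyXn -exprSr [X in _ + X](_ : _ = 0) ?addr0 //.
by apply/polyP=> j; rewrite coef_map coefXn coef0; case: eqP;
  rewrite /= ?sder1 ?raddf0.
Qed.

Lemma ore_mul1r : right_id 1 ore_mul.
Proof.
move=> p; rewrite /ore_mul -[RHS]coefK poly_def.
by apply: eq_bigr => i _; rewrite iter_shift1.
Qed.

End OreMul.

(* A record, rather than an alias of {poly R}, so that the twisted product can
   never be confused with the product of {poly R}.                            *)
Record ore (R : nzRingType) (sigma : {rmorphism R -> R})
    (delta : skew_derivation sigma) := Ore { ore_poly : {poly R} }.

Section OreRing.
Variables (R : nzRingType) (sigma : {rmorphism R -> R}).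
Variable delta : skew_derivation sigma.
Local Notation A := (ore delta).
Implicit Types x y z : A.

HB.instance Definition _ := [isNew for @ore_poly R sigma delta].
HB.instance Definition _ := [Choice of A by <:].

Lemma ore_poly_inj : injective (@ore_poly R sigma delta).
Proof. exact: val_inj. Qed.

Definition ore_add x y : A := Ore delta (ore_poly x + ore_poly y).
Definition ore_opp x : A := Ore delta (- ore_poly x).
Definition ore_times x y : A :=
  Ore delta (ore_mul delta (ore_poly x) (ore_poly y)).
Definition ore_scale (a : R) x : A := Ore delta (a *: ore_poly x).

Fact ore_addA : associative ore_add.
Proof. by move=> x y z; apply: ore_poly_inj; rewrite /= addrA. Qed.
Fact ore_addC : commutative ore_add.
Proof. by move=> x y; apply: ore_poly_inj; rewrite /= addrC. Qed.
Fact ore_add0 : left_id (Ore delta 0) ore_add.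
Proof. by move=> x; apply: ore_poly_inj; rewrite /= add0r. Qed.
Fact ore_addN : left_inverse (Ore delta 0) ore_opp ore_add.
Proof. by move=> x; apply: ore_poly_inj; rewrite /= addNr. Qed.

HB.instance Definition _ :=
  GRing.isZmodule.Build A ore_addA ore_addC ore_add0 ore_addN.

Fact ore_timesA : associative ore_times.
Proof. by move=> x y z; apply: ore_poly_inj; rewrite /= ore_mulA. Qed.
Fact ore_times1l : left_id (Ore delta 1) ore_times.
Proof. by move=> x; apply: ore_poly_inj; rewrite /= ore_mul1l. Qed.
Fact ore_times1r : right_id (Ore delta 1) ore_times.
Proof. by move=> x; apply: ore_poly_inj; rewrite /= ore_mul1r. Qed.
Fact ore_timesDl : left_distributive ore_times +%R.
Proof. by move=> x y z; apply: ore_poly_inj; rewrite /= ore_mulDl. Qed.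
Fact ore_timesDr : right_distributive ore_times +%R.
Proof. by move=> x y z; apply: ore_poly_inj; rewrite /= ore_mulDr. Qed.
Fact ore_1neq0 : Ore delta 1 != 0.
Proof. by rewrite -(inj_eq ore_poly_inj) /= oner_eq0. Qed.

HB.instance Definition _ := GRing.Zmodule_isNzRing.Build A
  ore_timesA ore_times1l ore_times1r ore_timesDl ore_timesDr ore_1neq0.

Fact ore_scaleA a b x : ore_scale a (ore_scale b x) = ore_scale (a * b) x.
Proof. by apply: ore_poly_inj; rewrite /= scalerA. Qed.
Fact ore_scale1 : left_id 1 ore_scale.
Proof. by move=> x; apply: ore_poly_inj; rewrite /= scale1r. Qed.
Fact ore_scaleDr : right_distributive ore_scale +%R.
Proof. by move=> a x y; apply: ore_poly_inj; rewrite /= scalerDr. Qed.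
Fact ore_scaleDl x : {morph ore_scale^~ x : a b / a + b}.
Proof. by move=> a b; apply: ore_poly_inj; rewrite /= scalerDl. Qed.

HB.instance Definition _ := GRing.Zmodule_isLmodule.Build R A
  ore_scaleA ore_scale1 ore_scaleDr ore_scaleDl.

Fact ore_scaleAl (a : R) x y : a *: (x * y) = a *: x * y.
Proof. by apply: ore_poly_inj; rewrite /= ore_mulZl. Qed.

HB.instance Definition _ := GRing.Lmodule_isLalgebra.Build R A ore_scaleAl.

(* An element r of R is seen in A as r%:A. *)
Definition ore_t : A := Ore delta 'X.

Lemma ore_poly_is_additive : zmod_morphism (@ore_poly R sigma delta).
Proof. by []. Qed.
HB.instance Definition _ := GRing.isZmodMorphism.Build A {poly R}
  (@ore_poly R sigma delta) ore_poly_is_additive.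

Lemma ore_polyZ a x : ore_poly (a *: x) = a *: ore_poly x.
Proof. by []. Qed.

Lemma ore_polyM x y :
  ore_poly (x * y) = ore_mul delta (ore_poly x) (ore_poly y).
Proof. by []. Qed.

Lemma ore_poly_tM x : ore_poly (ore_t * x) = ore_shift delta (ore_poly x).
Proof.
by rewrite ore_polyM /ore_mul size_polyX !big_ord_recl big_ord0 !coefX /=
  scale0r add0r addr0 scale1r.
Qed.

Lemma ore_poly_tX i : ore_poly (ore_t ^+ i) = 'X^i.
Proof.
elim: i => [|i IHi]; first by [].
rewrite exprS ore_poly_tM IHi -(iter_shift1 delta i).
by rewrite -[X in X = _]/(iter i.+1 _ _) iter_shift1.
Qed.

(* The characterisation of the Ore extension R[t; sigma, delta]: A is free as
   a left R-module on the powers of t, and t r = sigma(r) t + delta(r).       *)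
Lemma ore_basis x : x = \sum_(i < size (ore_poly x)) (ore_poly x)`_i *: ore_t ^+ i.
Proof.
apply: ore_poly_inj; rewrite raddf_sum /= -{1}[ore_poly x]coefK poly_def.
by apply: eq_bigr => i _; rewrite ore_poly_tX.
Qed.

Lemma ore_free n (a : 'I_n -> R) :
  \sum_(i < n) a i *: ore_t ^+ i = 0 -> forall i, a i = 0.
Proof.
move=> /(congr1 (@ore_poly _ _ _)); rewrite raddf_sum /= => sum0 i.
have /(congr1 (fun p : {poly R} => p`_i)) := sum0.
rewrite coef_sum (bigD1 i) //= ore_poly_tX coefZ coefXn eqxx mulr1 coef0.
rewrite big1 ?addr0 // => j neq_ji; rewrite ore_poly_tX coefZ coefXn.
by rewrite eq_sym (inj_eq val_inj) (negPf neq_ji) mulr0.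
Qed.

Lemma ore_comm (r : R) : ore_t * r%:A = sigma r *: ore_t + (delta r)%:A.
Proof.
apply: ore_poly_inj; rewrite ore_poly_tM raddfD /= shiftZ.
congr (_ *: _ + _); exact: (iter_shift1 delta 1).
Qed.

End OreRing.

(* If R is graded, sigma preserves degrees and delta shifts them by d, then
   R[t; sigma, delta] is graded by the degrees of R and deg t = d.            *)
Section OreGrading.
Variables (R : nzRingType) (sigma : {rmorphism R -> R}).
Variables (delta : skew_derivation sigma) (G : grading R) (d : int).
Hypothesis sigmaG : forall n r, G n r -> G n (sigma r).
Hypothesis deltaG : forall n r, G n r -> G (n + d) (delta r).
Local Notation A := (ore delta).

Definition ore_hom (n : int) (x : A) : Prop :=
  forall j : nat, G (n - d * j%:Z) (ore_poly x)`_j.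

Lemma grD n x y : G n x -> G n y -> G n (x + y).
Proof.
move=> Gx Gy; rewrite -[y]opprK; apply: grB => //.
by rewrite -sub0r; apply: grB => //; apply: gr0.
Qed.

Lemma ore_hom0 n : ore_hom n 0.
Proof. by move=> j; rewrite /= coef0; apply: gr0. Qed.

Lemma ore_homB n x y : ore_hom n x -> ore_hom n y -> ore_hom n (x - y).
Proof. by move=> hx hy j; rewrite /= coefB; apply: grB. Qed.

Lemma ore_homD n x y : ore_hom n x -> ore_hom n y -> ore_hom n (x + y).
Proof. by move=> hx hy j; rewrite /= coefD; apply: grD. Qed.

Lemma ore_hom_sum n I (s : seq I) (F : I -> A) :
  (forall i, ore_hom n (F i)) -> ore_hom n (\sum_(i <- s) F i).
Proof.
move=> hF; elim/big_rec: _ => [|i x _ hx]; first exact: ore_hom0.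
exact: ore_homD.
Qed.

Lemma ore_hom_t n x : ore_hom n x -> ore_hom (d + n) (ore_t delta * x).
Proof.
move=> hx j; rewrite ore_poly_tM coef_shift; apply: grD.
  case: eqP => [_|/eqP]; first exact: gr0.
  case: j => // j _; apply: sigmaG => /=; have := hx j.
  by rewrite intS mulrDr mulr1 opprD addrA [d + n]addrC addrK.
by rewrite -addrA addrC; apply: deltaG.
Qed.

Lemma ore_hom_tX n i x :
  ore_hom n x -> ore_hom (d * i%:Z + n) (ore_t delta ^+ i * x).
Proof.
move=> hx; elim: i => [|i IHi]; first by rewrite mulr0 add0r expr0 mul1r.
by rewrite exprS -mulrA intS mulrDr mulr1 -addrA; apply: ore_hom_t.
Qed.

Lemma ore_homZ m n a x : G m a -> ore_hom n x -> ore_hom (m + n) (a *: x).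
Proof. by move=> Ga hx j; rewrite /= coefZ -addrA; apply: grM. Qed.

Lemma ore_homM m n x y : ore_hom m x -> ore_hom n y -> ore_hom (m + n) (x * y).
Proof.
move=> hx hy; rewrite (ore_basis x) mulr_suml; apply: ore_hom_sum => i.
rewrite -ore_scaleAl -(subrK (d * i%:Z) m) -addrA.
by apply: ore_homZ => //; apply: ore_hom_tX.
Qed.

Lemma ore_hom1 : ore_hom 0 1.
Proof.
move=> j; rewrite /= coef1; case: eqP => [->|_]; last exact: gr0.
by rewrite mulr0 subr0; apply: gr1.
Qed.

Lemma ore_hom_C n a : G n a -> ore_hom n a%:A.
Proof. by move=> Ga; rewrite -[n]addr0; apply: ore_homZ => //; apply: ore_hom1. Qed.

Lemma ore_hom_gen : ore_hom d (ore_t delta).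
Proof. by rewrite -[d]addr0 -[ore_t delta]mulr1; apply/ore_hom_t/ore_hom1. Qed.

Lemma ore_span x : exists (r : seq int) (c : int -> A),
  (forall n, ore_hom n (c n)) /\ x = \sum_(n <- r) c n.
Proof.
pose D y := exists (r : seq int) (c : int -> A),
  uniq r /\ (forall n, ore_hom n (c n)) /\ y = \sum_(n <- r) c n.
suff [r [c [_ ?]]] : D x by exists r, c.
have D0 : D 0.
  by exists [::], (fun=> 0); split=> //; split; [move=> n; apply: ore_hom0|rewrite big_nil].
have Dadd n y z : ore_hom n y -> D z -> D (y + z).
  move=> hy [r [c [Ur [hc ->]]]].
  pose c' k := if k == n then (if n \in r then c n else 0) + y else c k.
  exists (if n \in r then r else n :: r), c'; split; [|split].
  - by case: ifP => //= ->.
  - move=> k; rewrite /c'; case: eqP => [->|_] //.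
    by apply: ore_homD => //; case: ifP => _ //; apply: ore_hom0.
  have eqc' k : k != n -> c' k = c k by rewrite /c' => /negPf->.
  case: ifPn => nr.
    rewrite !(big_rem n nr) /= {1}/c' eqxx nr addrCA addrA.
    congr (_ + _); apply: eq_big_seq => k; rewrite mem_rem_uniq // => /andP[kn _].
    by rewrite eqc'.
  rewrite big_cons {1}/c' eqxx (negPf nr) add0r; congr (_ + _).
  apply: eq_big_seq => k kr; rewrite eqc' //.
  by apply: contraNneq nr => <-.
rewrite (ore_basis x).
elim/big_rec: _ => [|i y _ Dy]; first exact: D0.
have [r [c [hc ->]]] := gr_span G (ore_poly x)`_i.
rewrite scaler_suml; elim: r => [|k r IHr]; first by rewrite big_nil add0r.
rewrite big_cons -addrA; apply: (Dadd (k + d * i%:Z)) => //.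
apply: ore_homZ => //; rewrite -[d * _]addr0 -[_ ^+ i]mulr1.
exact/ore_hom_tX/ore_hom1.
Qed.

Lemma ore_indep (r : seq int) (c : int -> A) : uniq r ->
  (forall n, ore_hom n (c n)) -> \sum_(n <- r) c n = 0 ->
  forall n, n \in r -> c n = 0.
Proof.
move=> Ur hc sum0 n nr; apply: ore_poly_inj; apply/polyP => j; rewrite coef0.
pose f (k : int) := k - d * j%:Z.
have finj : injective f by move=> k l /addIr.
pose b k := (ore_poly (c (k + d * j%:Z)))`_j.
have hb k : G k (b k) by have := hc (k + d * j%:Z) j; rewrite addrK.
have := @gr_indep _ G (map f r) b _ hb _ (f n) (map_f f nr).
rewrite map_inj_uniq // => /(_ Ur); rewrite /b /f subrK; apply.
rewrite big_map; have /(congr1 (fun x : A => (ore_poly x)`_j)) := sum0.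
rewrite raddf_sum coef_sum coef0 => sum0j; rewrite -[RHS]sum0j.
by apply: eq_bigr => k _; rewrite subrK.
Qed.

Definition ore_grading : grading A :=
  Grading ore_hom0 ore_homB ore_hom1 ore_homM ore_span ore_indep.

End OreGrading.

Section Example.
Local Notation R := {poly rat}.
Implicit Types f g : R.

(* f(x) |-> f(2x) *)
Definition sigmaE : {rmorphism R -> R} := comp_poly (2%:R *: 'X).

(* The division is exact, see deltaE_exact. *)
Definition deltaE_fun f : R := (sigmaE f - f) %/ 'X.

Lemma coef_sigmaE f i : (sigmaE f)`_i = 2%:R ^+ i * f`_i.
Proof.
rewrite /= coef_comp_poly; under eq_bigr do rewrite exprZn coefZ coefXn.
case: (ltnP i (size f)) => [lt_i|le_i].
  rewrite (bigD1 (Ordinal lt_i)) //= eqxx mulr1 mulrC big1 ?addr0 // => j.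
  rewrite -(inj_eq val_inj) /= eq_sym => /negPf->; by rewrite !mulr0.
rewrite (nth_default _ le_i) mulr0 big1 // => j _.
by rewrite (gtn_eqF (leq_trans (ltn_ord j) le_i)) !mulr0.
Qed.

Lemma deltaE_exact f : deltaE_fun f * 'X = sigmaE f - f.
Proof.
apply: divpK; rewrite -['X]subr0 -polyC0 dvdp_XsubCl /root horner_coef0.
by rewrite coefB coef_sigmaE expr0 mul1r subrr.
Qed.

Lemma coef_deltaE f i : (deltaE_fun f)`_i = (2%:R ^+ i.+1 - 1) * f`_i.+1.
Proof.
have /(congr1 (fun p : R => p`_i.+1)) := deltaE_exact f.
by rewrite coefMX /= coefB coef_sigmaE mulrBl mul1r.
Qed.

Lemma deltaE_is_additive : zmod_morphism deltaE_fun.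
Proof.
by move=> f g; apply/polyP=> i; rewrite coefB !coef_deltaE coefB mulrBr.
Qed.
HB.instance Definition _ :=
  GRing.isZmodMorphism.Build R R deltaE_fun deltaE_is_additive.

Lemma deltaE_M f g :
  deltaE_fun (f * g) = deltaE_fun f * g + sigmaE f * deltaE_fun g.
Proof.
apply: (mulIf (negbT (polyX_eq0 rat))).
rewrite mulrDl [X in X + _]mulrAC -[X in _ + X]mulrA !deltaE_exact rmorphM.
by rewrite mulrBl mulrBr [RHS]addrC addrA subrK.
Qed.

Definition deltaE : skew_derivation sigmaE := @SkewDerivation _ sigmaE deltaE_fun deltaE_M.

(* The component of degree n is spanned by x^n if n >= 0, and 0 otherwise. *)
Definition X_hom (n : int) f : Prop := forall i : nat, f`_i != 0 -> i%:Z = n.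

Lemma X_hom0 n : X_hom n 0.
Proof. by move=> i; rewrite coef0 eqxx. Qed.

Lemma X_homB n f g : X_hom n f -> X_hom n g -> X_hom n (f - g).
Proof.
move=> hf hg i; rewrite coefB; have [fi0|/hf] := eqVneq f`_i 0; last by [].
by rewrite fi0 sub0r oppr_eq0 => /hg.
Qed.

Lemma X_hom1 : X_hom 0 1.
Proof. by move=> i; rewrite coef1; case: (i) => // j; rewrite eqxx. Qed.

Lemma X_homM m n f g : X_hom m f -> X_hom n g -> X_hom (m + n) (f * g).
Proof.
move=> hf hg i; rewrite coefM; apply: contraNeq => neq.
apply/eqP/big1 => j _; apply/eqP; apply: contraNT neq.
rewrite mulf_eq0 negb_or => /andP[/hf <- /hg <-].
by rewrite -PoszD subnKC // -ltnS.
Qed.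

Lemma X_span f : exists (r : seq int) (c : int -> R),
  (forall n, X_hom n (c n)) /\ f = \sum_(n <- r) c n.
Proof.
pose c (n : int) : R := if n is Posz k then f`_k *: 'X^k else 0.
exists [seq Posz i | i <- iota 0 (size f)], c; split=> [[k|k]|].
- move=> i /=; rewrite coefZ coefXn; case: (i =P k) => [->//|_].
  by rewrite mulr0 eqxx.
- exact: X_hom0.
rewrite big_map -{1}[f]coefK poly_def -[iota 0 _](val_enum_ord) big_map.
by rewrite big_enum.
Qed.

Lemma X_indep (r : seq int) (c : int -> R) : uniq r ->
  (forall n, X_hom n (c n)) -> \sum_(n <- r) c n = 0 ->
  forall n, n \in r -> c n = 0.
Proof.
move=> Ur hc sum0 n nr; apply/polyP=> i; rewrite coef0.
apply/eqP/negP => /negP ci; have def_n := hc n i ci.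
have /(congr1 (fun p : R => p`_i)) := sum0.
rewrite coef_sum (bigD1_seq n) //= coef0 big1 ?addr0 => [ci0|k neq_kn].
  by rewrite ci0 eqxx in ci.
apply/eqP; apply: contraNT neq_kn => /hc <-; by rewrite def_n.
Qed.

Definition gradingR : grading R :=
  Grading X_hom0 X_homB X_hom1 X_homM X_span X_indep.

Lemma sigmaE_hom n f : gradingR n f -> gradingR n (sigmaE f).
Proof.
by move=> hf i; rewrite coef_sigmaE mulf_eq0 negb_or => /andP[_ /hf].
Qed.

Lemma deltaE_hom n f : gradingR n f -> gradingR (n + -1) (deltaE f).
Proof.
move=> hf i; rewrite coef_deltaE mulf_eq0 negb_or => /andP[_ /hf <-].
by rewrite intS addrAC subrr add0r.
Qed.

Definition oreA := ore deltaE.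

Definition gradingA : grading oreA := ore_grading sigmaE_hom deltaE_hom.

Definition xA : oreA := 'X%:A.
Definition tA : oreA := ore_t deltaE.

Lemma gradingA_x : gradingA 1 xA.
Proof.
apply: ore_hom_C => i; rewrite coefX.
by case: i => [|[|i]] //; rewrite eqxx.
Qed.

Lemma gradingA_t : gradingA (-1) tA.
Proof. exact: ore_hom_gen sigmaE_hom deltaE_hom. Qed.

(* The free algebra Q<x, t>, as the algebra of the free monoid on two letters. *)
Definition freeQ := {malg rat[{fmonom 'I_2}]}.
Definition xF : freeQ := << fmu ord0 >>.
Definition tF : freeQ := << fmu ord_max >>.

End Example.

(* Main.v *)
Require Import Defs.
From HB Require Import structures.
From mathcomp Require Import all_boot all_order all_algebra.
From mathcomp Require Import monalg.
From Stdlib Require Import Classical.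

Set Implicit Arguments.
Unset Strict Implicit.
Unset Printing Implicit Defensive.

Import GRing.Theory.
Local Open Scope ring_scope.

(** The Ore extension [A] has generators [xA], [tA] with [t x = 2 x t + 1],
    because [sigmaE 'X = 2 'X] and [deltaE 'X = 1].

    Presentation. The free algebra maps onto [A] by evaluating words ([evalA]).
    Modulo any ideal that contains [t x - 2 x t - 1], the letter [t] can be
    pushed to the right past a polynomial in [x], with the same result as in [A]
    ([t_mul_coef]); so every element of the free algebra is congruent to the
    normal form with coefficients in Q[x] to the left of the powers of [t],
    read off from its image in [A] ([nform_evalA]). An element with image 0 is
    then congruent to 0, that is, it lies in every such ideal.

    Simplicity of the base. Since [deltaE] sends [x ^+ n.+1] to
    [(2 ^+ n.+1 - 1) x ^+ n], it lowers the degree of a nonconstant polynomial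
    by exactly one. Applying it repeatedly to a nonzero element of a stable
    ideal produces a nonzero constant ([deltaE_ideal_whole]).

    Outerness. An inner derivation of the commutative ring Q[x] given by [u]
    sends ['X] to [- u * 'X], which vanishes at 0, whereas [deltaE 'X = 1].

    Non-simplicity of [A]. The element [z = 1 + x t] of degree 0 satisfies
    [z x = 2 x z] and [t z = 2 z t], so it is normal: [A z] is contained in
    [z A] ([zA_normal]), and [z A] is a two-sided ideal. As [sigmaE] is
    injective, multiplication by [z] raises the degree in [t] by one
    ([size_zA]); so [z] is not a unit and the graded ideal that it generates is
    neither 0 nor [A]. *)

(** * Ideals *)

Section Ideals.
Variable S : nzRingType.
Implicit Types (I X : S -> Prop) (x y z : S).

Lemma idealN I x : is_ideal I -> I x -> I (- x).
Proof. by move=> idI Ix; rewrite -sub0r; apply: idealB => //; apply: ideal0. Qed.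

Lemma idealD I x y : is_ideal I -> I x -> I y -> I (x + y).
Proof.
by move=> idI Ix Iy; rewrite -[y]opprK; apply: idealB => //; apply: idealN.
Qed.

Lemma ideal_gen_is_ideal X : is_ideal (ideal_gen X).
Proof.
split=> [I idI _|x y hx hy I idI XI|a x hx I idI XI|a x hx I idI XI].
- exact: ideal0.
- by apply: idealB => //; [apply: hx|apply: hy].
- by apply: (Defs.idealMl idI) => //; apply: hx.
- by apply: (Defs.idealMr idI) => //; apply: hx.
Qed.

Lemma ideal_gen_sub X x : X x -> ideal_gen X x.
Proof. by move=> Xx I _; apply. Qed.

Lemma ker_is_ideal (T : nzRingType) (f : {rmorphism S -> T}) :
  is_ideal (fun x => f x = 0).
Proof.
split=> [|x y fx fy|a x fx|a x fx]; first exact: rmorph0.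
- by rewrite rmorphB fx fy subrr.
- by rewrite rmorphM fx mulr0.
- by rewrite rmorphM fx mul0r.
Qed.

Lemma rmorph_rel_eq0 (T : nzRingType) (f : {rmorphism S -> T}) x y (x' y' : T) :
    f x = x' -> f y = y' -> y' * x' = 2%:R * (x' * y') + 1 ->
  f (y * x - 2%:R * (x * y) - 1) = 0.
Proof.
move=> fx fy rel; rewrite !rmorphB !rmorphM rmorph_nat rmorph1 fx fy rel.
by rewrite addrAC addrK subrr.
Qed.

Lemma ideal_gen1_graded (G : grading S) x :
  homogeneous G x -> graded_ideal G (ideal_gen (eq x)).
Proof. by move=> Gx; exists (eq x); split=> // _ <-. Qed.

Definition congr_mod I x y := I (x - y).

Lemma congr_refl I x : is_ideal I -> congr_mod I x x.
Proof. by move=> idI; rewrite /congr_mod subrr; apply: ideal0. Qed.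

Lemma congr_trans I y x z :
  is_ideal I -> congr_mod I x y -> congr_mod I y z -> congr_mod I x z.
Proof. by move=> idI xy yz; have := idealD idI xy yz; rewrite subrKA. Qed.

Lemma congrD I x1 y1 x2 y2 : is_ideal I ->
  congr_mod I x1 y1 -> congr_mod I x2 y2 -> congr_mod I (x1 + x2) (y1 + y2).
Proof.
by move=> idI h1 h2; rewrite /congr_mod opprD addrACA; apply: idealD.
Qed.

Lemma congrMl I a x y :
  is_ideal I -> congr_mod I x y -> congr_mod I (a * x) (a * y).
Proof. by move=> idI h; rewrite /congr_mod -mulrBr; apply: (Defs.idealMl idI). Qed.

Lemma congrMr I a x y :
  is_ideal I -> congr_mod I x y -> congr_mod I (x * a) (y * a).
Proof. by move=> idI h; rewrite /congr_mod -mulrBl; apply: (Defs.idealMr idI). Qed.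

(** The set of products [z * s] is a priori only a right ideal; it is two-sided
    as soon as [z] can be moved to the front of every [a * z]. *)
Lemma normal_ideal z : (forall a, exists b, a * z = z * b) ->
  is_ideal (fun x => exists s, x = z * s).
Proof.
move=> nz; split=> [|_ _ [s ->] [s' ->]|a _ [s ->]|a _ [s ->]].
- by exists 0; rewrite mulr0.
- by exists (s - s'); rewrite mulrBr.
- by have [b ab] := nz a; exists (b * s); rewrite mulrA ab mulrA.
- by exists (s * a); rewrite mulrA.
Qed.

End Ideals.

(** * The ring Q[x] with its skew derivation *)

Section Base.
Local Notation R := {poly rat}.
Implicit Types f g : R.

Lemma sigmaE_inj : injective sigmaE.
Proof.
move=> f g /polyP fg; apply/polyP=> i; have := fg i; rewrite !coef_sigmaE.
by apply: mulfI; rewrite expf_neq0.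
Qed.

Lemma sigmaE_C (c : rat) : sigmaE c%:P = c%:P.
Proof. exact: comp_polyC. Qed.

Lemma sigmaE_X : sigmaE 'X = 2%:R * 'X.
Proof. by rewrite /= comp_polyX -mul_polyC rmorph_nat. Qed.

Lemma deltaE_C (c : rat) : deltaE c%:P = 0.
Proof. by apply/polyP=> i; rewrite coef_deltaE coefC coef0 mulr0. Qed.

Lemma deltaE_X : deltaE 'X = 1.
Proof.
apply/polyP=> i; rewrite coef_deltaE coefX coef1 eqSS.
by case: i => [|i]; rewrite ?mulr0.
Qed.

(** The coefficient [2 ^+ i.+1 - 1] of [x ^+ i] in [deltaE (x ^+ i.+1)] never
    vanishes in characteristic zero, so [deltaE] lowers degrees by exactly 1,
    as the ordinary derivative does. *)
Lemma size_deltaE f : size (deltaE f) = (size f).-1.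
Proof.
have nz i : (2%:R : rat) ^+ i.+1 - 1 != 0.
  rewrite subr_eq0 -natrX (Num.Theory.eqr_nat _ _ 1).
  by rewrite gtn_eqF // (ltn_exp2l 0).
have [->|f0] := eqVneq f 0; first by rewrite raddf0 size_poly0.
apply/eqP; rewrite eqn_leq; apply/andP; split.
  apply/leq_sizeP=> i le_i; rewrite coef_deltaE nth_default ?mulr0 //.
  by rewrite (leq_trans (leqSpred _)).
case sz: (size f) => [|[|n]] //=; rewrite ltnNge; apply/negP=> /leq_sizeP.
move/(_ n (leqnn n))/eqP; rewrite coef_deltaE mulf_eq0 (negPf (nz n)) /=.
by have := lead_coef_eq0 f; rewrite lead_coefE sz /= => ->; apply/negP.
Qed.

(** Applying [deltaE] repeatedly to [f] ends in a nonzero constant, which is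
    invertible. *)
Lemma deltaE_ideal_whole (I : R -> Prop) f : is_ideal I ->
  (forall r, I r -> I (deltaE r)) -> I f -> f != 0 -> forall g, I g.
Proof.
move=> idI stab; move: {2}(size f) (erefl (size f)) => n.
elim: n f => [|[|n] IHn] f sz If f0 g.
- by move/eqP: sz; rewrite size_poly_eq0 (negPf f0).
- move/eqP/size_poly1P: sz => [c c0 def_f].
  have -> : g = g * c^-1%:P * f.
    by rewrite def_f -mulrA -polyCM mulVf // mulr1.
  exact: (Defs.idealMl idI).
- have szd := size_deltaE f; rewrite sz /= in szd.
  by apply: (IHn (deltaE f)) => //; [apply: stab|rewrite -size_poly_gt0 szd].
Qed.

Lemma sd_gr_simple_E : sd_gr_simple deltaE gradingR.
Proof.
move=> I [X [_ defI]] _ stab; have [idX0 idXB idXMl idXMr] := ideal_gen_is_ideal X.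
have idI : is_ideal I.
  by split=> [|x y /defI hx /defI hy|a x /defI hx|a x /defI hx]; apply/defI; auto.
have [[f [If f0]]|none] := classic (exists f, I f /\ f != 0).
  by right; apply: deltaE_ideal_whole If f0.
left=> s; split=> [Is|->]; last exact: ideal0.
by have [//|s0] := eqVneq s 0; case: none; exists s.
Qed.

(** If [deltaE] were given by [u] then [1 = deltaE 'X = u * 'X - 2 * 'X * u]
    would be divisible by ['X]. *)
Lemma deltaE_outer : outer deltaE.
Proof.
case=> u /(_ 'X); rewrite deltaE_X sigmaE_X => /(congr1 (horner^~ 0)).
by rewrite !hornerE => /eqP; rewrite oner_eq0.
Qed.

End Base.

(** * The Ore extension A *)

Section Extension.
Local Notation R := {poly rat}.
Implicit Types (a b : oreA) (c : rat) (r : R).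

Definition cstA : {rmorphism rat -> oreA} := (in_alg oreA \o polyC)%FUN.

Lemma tA_xA : tA * xA = 2%:R * (xA * tA) + 1.
Proof.
rewrite /tA /xA ore_comm sigmaE_X deltaE_X scale1r; congr (_ + _).
by rewrite mulr_algl !mulr_natl scalerMnl.
Qed.

(** Rational constants are fixed by [sigmaE] and killed by [deltaE]. *)
Lemma cstA_central c a : GRing.comm (cstA c) a.
Proof.
have comm_t : GRing.comm (cstA c) tA.
  rewrite /GRing.comm [RHS]ore_comm sigmaE_C deltaE_C scale0r addr0.
  exact: mulr_algl.
rewrite (ore_basis a); apply: commr_sum => i _; rewrite -mulr_algl.
apply: commrM; last exact: commrX.
by have := congr1 (in_alg oreA) (mulrC c%:P (ore_poly a)`_i); rewrite !rmorphM.
Qed.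

(** Generation of [A] by the rationals, [xA] and [tA], in the form of an
    induction principle: it gives both the surjectivity in the presentation and
    the normality of the element [zA] below. *)
Lemma oreA_ind (P : oreA -> Prop) :
    (forall c, P (cstA c)) -> P xA -> P tA ->
    (forall a b, P a -> P b -> P (a + b)) ->
    (forall a b, P a -> P b -> P (a * b)) ->
  forall a, P a.
Proof.
move=> Pc Px Pt PD PM a.
have P0 : P 0 by rewrite -(rmorph0 cstA).
have P1 : P 1 by rewrite -(rmorph1 cstA).
have Pr r : P r%:A.
  elim/poly_ind: r => [|r c IHr]; first by rewrite scale0r.
  rewrite scalerDl; apply: PD; last exact: Pc.
  have -> : (r * 'X)%:A = r%:A * xA by exact: (rmorphM (in_alg oreA)).
  exact: PM.
rewrite (ore_basis a); elim/big_rec: _ => // i b _ Pb; apply: PD => //.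
rewrite -mulr_algl; apply: (PM) => //.
by elim: (i : nat) => [|n IHn]; rewrite ?expr0 // exprS; apply: PM.
Qed.

(** The normal element [1 + x t]; it equals the commutator [t x - x t]. *)
Definition zA : oreA := 1 + xA * tA.

Lemma gradingA_zA : gradingA 0 zA.
Proof.
apply: (grD (G := gradingA)); first exact: gr1.
exact: (grM gradingA_x gradingA_t).
Qed.

Lemma zA_xA : zA * xA = 2%:R * (xA * zA).
Proof.
rewrite /zA mulrDl mul1r -mulrA tA_xA !mulrDr !mulr1 !mulr_natl mulrnAr.
by rewrite addrCA -mulr2n addrC.
Qed.

Lemma tA_zA : tA * zA = zA * (2%:R * tA).
Proof.
rewrite /zA mulrDr mulr1 mulrA tA_xA !mulr_natl !mulrDl !mul1r mulrnAr.
by rewrite addrCA addrC addrA -!mulr2n.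
Qed.

(** It suffices to commute [zA] with the generators; the factor 2 of
    [zA_xA] has to be inverted in the case of [xA]. *)
Lemma zA_normal a : exists b, a * zA = zA * b.
Proof.
elim/oreA_ind: a => [c|||a b [a' ha] [b' hb]|a b [a' ha] [b' hb]].
- by exists (cstA c); rewrite cstA_central.
- exists (cstA 2%:R^-1 * xA).
  rewrite mulrA -cstA_central -mulrA zA_xA mulrA -(rmorph_nat cstA) -rmorphM.
  by rewrite mulVf // rmorph1 mul1r.
- by exists (2%:R * tA); apply: tA_zA.
- by exists (a' + b'); rewrite mulrDl ha hb -mulrDr.
- by exists (a' * b'); rewrite -mulrA hb mulrA ha mulrA.
Qed.

Lemma ore_poly_zA a :
  ore_poly (zA * a) = ore_poly a + 'X *: ore_shift deltaE (ore_poly a).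
Proof.
by rewrite /zA mulrDl mul1r -mulrA raddfD -ore_poly_tM /xA mulr_algl.
Qed.

(** If [c] is the leading coefficient of [a] in [t], then that of [zA * a] is
    ['X * sigmaE c], one degree higher; it is nonzero because [sigmaE] is
    injective. *)
Lemma size_zA a : a != 0 ->
  size (ore_poly (zA * a)) = (size (ore_poly a)).+1.
Proof.
rewrite -(inj_eq (@ore_poly_inj _ _ _)) ore_poly_zA.
move: (ore_poly a) => p p0; apply/eqP; rewrite eqn_leq; apply/andP; split.
  apply/leq_sizeP=> -[//|j] le_j; rewrite coefD coefZ coef_shift /=.
  by rewrite !(nth_default _ (leqW le_j), nth_default _ le_j) !raddf0 add0r
    addr0 mulr0.
have szp : (size p).-1.+1 = size p by rewrite prednK // size_poly_gt0.
rewrite ltnNge; apply/negP=> /leq_sizeP/(_ _ (leqnn _))/eqP.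
rewrite coefD coefZ coef_shift size_poly_eq0 (negPf p0) nth_default // raddf0.
rewrite addr0 add0r mulf_eq0 polyX_eq0 -[X in _ == X](raddf0 sigmaE).
rewrite (inj_eq sigmaE_inj) -lead_coefE lead_coef_eq0; exact/negP.
Qed.

Lemma gradingA_not_simple : ~ gr_simple gradingA.
Proof.
have Gz : homogeneous gradingA zA by exists 0; apply: gradingA_zA.
move=> /(_ _ (ideal_gen1_graded Gz)) [zero|whole].
  have z0 : zA = 0 by apply: (zero zA).1; apply: ideal_gen_sub.
  have: (0 < size (ore_poly (zA * 1)%R))%N by rewrite size_zA ?oner_neq0.
  by rewrite size_poly_gt0 (inj_eq (@ore_poly_inj _ _ _) _ 0) mulr1 z0 eqxx.
have [|b z1] := whole 1 _ (normal_ideal zA_normal).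
  by move=> _ <-; exists 1; rewrite mulr1.
have b0 : b != 0.
  by apply: contra_eq_neq z1 => ->; rewrite mulr0 oner_neq0.
have := size_zA b0; rewrite -z1 size_poly1 => /esym/eqP.
by rewrite eqSS size_poly_eq0 (inj_eq (@ore_poly_inj _ _ _) _ 0) (negPf b0).
Qed.

End Extension.

(** * Normal forms modulo the defining relation *)

Section NormalForms.
Local Notation R := {poly rat}.
Variables (B : nzRingType) (h : {rmorphism R -> B}) (t : B).

(** Substitution of [t] for the variable of the Ore extension, with the
    coefficients, embedded by [h], kept on the left. It is merely additive: the
    lemmas below measure how far it is from being multiplicative for the
    twisted product. *)
Definition nform (p : {poly R}) : B := (map_poly h p).[t].

Lemma nform0 : nform 0 = 0.
Proof. by rewrite /nform raddf0 horner0. Qed.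

Lemma nformD p q : nform (p + q) = nform p + nform q.
Proof. by rewrite /nform rmorphD hornerD. Qed.

Lemma nformMX p : nform (p * 'X) = nform p * t.
Proof. by rewrite /nform rmorphM /= map_polyX hornerMX. Qed.

Lemma nformZ r p : nform (r *: p) = h r * nform p.
Proof. by rewrite /nform map_polyZ hornerZ. Qed.

Lemma nformC r : nform r%:P = h r.
Proof. by rewrite /nform map_polyC hornerC. Qed.

Variable I : B -> Prop.
Hypotheses (idI : is_ideal I) (relI : I (t * h 'X - 2%:R * (h 'X * t) - 1)).
Hypothesis ht : forall c : rat, GRing.comm t (h c%:P).

(** Both sides are additive in [r], and the rule for [r * 'X] follows from that
    for [r] by one application of the relation to [t * h 'X]: this is the
    Leibniz rule for [deltaE]. *)
Lemma t_mul_coef r :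
  congr_mod I (t * h r) (h (sigmaE r) * t + h (deltaE r)).
Proof.
elim/poly_ind: r => [|r c IHr].
  by rewrite !raddf0 mulr0 mul0r addr0; apply: congr_refl.
have tx : congr_mod I (t * h 'X) (2%:R * h 'X * t + 1).
  by rewrite /congr_mod opprD addrA -mulrA.
have -> : t * h (r * 'X + c%:P) = t * h r * h 'X + h c%:P * t.
  by rewrite rmorphD rmorphM mulrDr mulrA ht.
have -> : h (sigmaE (r * 'X + c%:P)) * t + h (deltaE (r * 'X + c%:P))
   = h (sigmaE r) * (2%:R * h 'X * t + 1) + h (deltaE r) * h 'X
     + h c%:P * t.
  rewrite [sigmaE _]rmorphD [sigmaE (r * _)]rmorphM sigmaE_C sigmaE_X.
  rewrite [deltaE _]raddfD sderM deltaE_C deltaE_X addr0 mulr1.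
  rewrite !rmorphD !rmorphM rmorph_nat.
  rewrite mulrDl mulrDr mulr1 -!mulrA [RHS]addrAC -!addrA; congr (_ + _).
  by rewrite addrCA [h _ + _]addrC.
apply: congrD => //; last exact: congr_refl.
apply: (congr_trans idI (congrMr (h 'X) idI IHr)).
rewrite mulrDl -mulrA; apply: congrD => //; last exact: congr_refl.
exact: congrMl.
Qed.

(** Left multiplication by [t] in the Ore extension is [ore_shift], so modulo
    [I] it is matched by left multiplication by [t] in [B]. *)
Lemma t_mul_nform p : congr_mod I (t * nform p) (nform (ore_shift deltaE p)).
Proof.
elim/poly_ind: p => [|p r IHp].
  by rewrite raddf0 nform0 mulr0; apply: congr_refl.
have shiftC : ore_shift deltaE r%:P = (sigmaE r)%:P * 'X + (deltaE r)%:P.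
  by rewrite /ore_shift !map_polyC.
have shiftMX : ore_shift deltaE (p * 'X) = ore_shift deltaE p * 'X.
  by apply/polyP=> -[|[|j]]; rewrite coefMX !coef_shift !coefMX /= ?raddf0 ?addr0.
rewrite raddfD /= shiftC shiftMX !nformD !nformMX !nformC mulrDr mulrA.
apply: congrD => //; first exact: congrMr.
exact: t_mul_coef.
Qed.

End NormalForms.

(** * The presentation *)

Section Presentation.
Local Notation R := {poly rat}.

Definition letterA (i : 'I_2) : oreA := if i == ord0 then xA else tA.
Definition wordA (m : {fmonom 'I_2}) : oreA := \prod_(i <- m) letterA i.

Lemma wordA_mmorphism : mmorphism wordA.
Proof. by split=> [m m'|]; rewrite /wordA ?fmM ?big_cat // fm1 big_nil. Qed.
HB.instance Definition _ :=
  monalg.isMultiplicative.Build {fmonom 'I_2} oreA wordA wordA_mmorphism.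

Definition evalA : freeQ -> oreA := mmap cstA wordA.

Lemma evalA_zmod : zmod_morphism evalA.
Proof. exact: raddfB. Qed.
HB.instance Definition _ :=
  GRing.isZmodMorphism.Build freeQ oreA evalA evalA_zmod.

(** [A] is not commutative, but evaluation is multiplicative all the same,
    because the coefficients are sent to central elements. *)
Lemma evalA_monoid : monoid_morphism evalA.
Proof.
have [] := @commr_mmap_is_multiplicative _ _ _ cstA wordA.
  by move=> g m m'; apply: cstA_central.
by move=> hM h1; split.
Qed.
HB.instance Definition _ :=
  GRing.isMonoidMorphism.Build freeQ oreA evalA evalA_monoid.

Lemma evalA_U c m : evalA << c *g m >> = cstA c * wordA m.
Proof. exact: mmapU. Qed.

Lemma evalA_xF : evalA xF = xA.
Proof. by rewrite evalA_U rmorph1 mul1r /wordA /= fmU big_seq1. Qed.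

Lemma evalA_tF : evalA tF = tA.
Proof. by rewrite evalA_U rmorph1 mul1r /wordA /= fmU big_seq1. Qed.

Definition cstF : {rmorphism rat -> freeQ} := @malgC {fmonom 'I_2} rat.

Lemma evalA_C c : evalA (cstF c) = cstA c.
Proof. exact: mmapC. Qed.

Lemma cstF_central f c : GRing.comm f (cstF c).
Proof.
rewrite (monalgE f); apply/commr_sym/commr_sum => m _.
rewrite /GRing.comm malgM_def fgmulUU mul1m.
by rewrite [RHS]malgM_def fgmulUU mulm1 mulrC.
Qed.

Lemma evalA_surj a : exists f, evalA f = a.
Proof.
elim/oreA_ind: a => [c|||a b [f <-] [g <-]|a b [f <-] [g <-]].
- by exists (cstF c); apply: evalA_C.
- by exists xF; apply: evalA_xF.
- by exists tF; apply: evalA_tF.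
- by exists (f + g); rewrite rmorphD.
- by exists (f * g); rewrite rmorphM.
Qed.

Definition liftR : {rmorphism R -> freeQ} := horner_morph (cstF_central xF).

Lemma liftR_X : liftR 'X = xF.
Proof. exact: horner_morphX. Qed.

Lemma liftR_C c : liftR c%:P = cstF c.
Proof. exact: horner_morphC. Qed.

Section Kernel.
Variable I : freeQ -> Prop.
Hypotheses (idI : is_ideal I) (relI : I (tF * xF - 2%:R * (xF * tF) - 1)).

Local Notation nform := (nform liftR tF).

(** For the letter [x] this is an equality, coefficients being on the left in
    normal forms; only the letter [t] uses the relation. *)
Lemma letter_nform i a : congr_mod I (<< fmu i >> * nform (ore_poly a))
  (nform (ore_poly (letterA i * a))).
Proof.
rewrite /letterA; have [->|i1] := eqVneq i ord0.
  by rewrite mulr_algl nformZ liftR_X; apply: congr_refl.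
have -> : i = ord_max by case: i i1 => [[|[|//]] lti] // _; apply: val_inj.
have relI' : I (tF * liftR 'X - 2%:R * (liftR 'X * tF) - 1).
  by rewrite liftR_X.
have ht c : GRing.comm tF (liftR c%:P) by rewrite liftR_C; apply: cstF_central.
rewrite (_ : ore_poly (_ * _) = ore_shift deltaE (ore_poly a)).
  exact: (t_mul_nform idI relI' ht).
exact: ore_poly_tM.
Qed.

(** Induction on the length of words, adding letters on the left: a letter
    times a normal form is congruent to a normal form. *)
Lemma nform_evalA f : congr_mod I f (nform (ore_poly (evalA f))).
Proof.
have word m : congr_mod I << m >> (nform (ore_poly (wordA m))).
  case: m => s; elim: s => [|i s IHs].
    rewrite /wordA big_nil nformC rmorph1 -fmoneE; exact: congr_refl.
  have -> : << FMonom (i :: s) >> = << fmu i >> * << FMonom s >> :> freeQ.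
    by rewrite malgM_def fgmulUU mulr1 fmuE -[mmul _ _]/(fmmul _ _) fmmulE.
  apply: (congr_trans idI (congrMl _ idI IHs)).
  rewrite {2}/wordA big_cons -/(wordA (FMonom s)).
  exact: letter_nform.
rewrite (monalgE f); elim/big_rec: _ => [|m g _ IHg].
  by rewrite raddf0 nform0; apply: congr_refl.
have nfD (g1 g2 : freeQ) : nform (ore_poly (evalA (g1 + g2)))
    = nform (ore_poly (evalA g1)) + nform (ore_poly (evalA g2)).
  by rewrite !raddfD nformD.
rewrite nfD; apply: (congrD idI _ IHg).
rewrite evalA_U mulr_algl nformZ liftR_C.
have -> : << f@_m *g m >> = cstF f@_m * << m >> :> freeQ.
  by rewrite malgM_def fgmulUU mulr1 mul1m.
exact: congrMl (word m).
Qed.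

End Kernel.

(** Normal forms give the hard inclusion: an element of the kernel is congruent
    to the normal form of 0 modulo each ideal containing the relation. *)
Lemma evalA_kernel f : evalA f = 0 <->
  ideal_gen (fun r => r = tF * xF - 2%:R * (xF * tF) - 1) f.
Proof.
split=> [f0 I idI relI|].
  have := nform_evalA idI (relI _ erefl) f.
  by rewrite f0 raddf0 nform0 /congr_mod subr0.
move/(_ _ (ker_is_ideal evalA)); apply=> _ ->.
exact: rmorph_rel_eq0 evalA_xF evalA_tF tA_xA.
Qed.

End Presentation.

Theorem proposition3p2 :
  [/\ (* the presentation oreA = Q<x, t> / (t x - 2 x t - 1) *)
      exists phi : {rmorphism freeQ -> oreA},
        [/\ phi xF = xA, phi tF = tA,
            forall a : oreA, exists f : freeQ, phi f = a &
            forall f : freeQ, phi f = 0 <->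
              ideal_gen (fun r => r = tF * xF - 2%:R * (xF * tF) - 1) f],
      sd_gr_simple deltaE gradingR,
      outer deltaE &
      ~ gr_simple gradingA].
Proof.
split.
- exists evalA; split.
  + exact: evalA_xF.
  + exact: evalA_tF.
  + exact: evalA_surj.
  + exact: evalA_kernel.
- exact: sd_gr_simple_E.
- exact: deltaE_outer.
- exact: gradingA_not_simple.
Qed.
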